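(* Let $0<M<N$ be integers, let $a_{ij}\in\mathbb{R}$ ($i=1,\dots,M$, $j=1,\dots,N$) and $g_i\in\mathbb{R}$ ($i=1,\dots,M$) be given, and assume that $$\sum_{j=1}^N a_{ij}\ge 0,\quad i=1,\dots,M,\qquad\qquad \sum_{i,j=1}^M v_i\,a_{ij}\,v_j>0\quad\forall\,(v_1,\dots,v_M)\in\mathbb{R}^M\setminus\{0\}.$$ Let index sets $S_i$ satisfy $\{j\in\{1,\dots,N\}\setminus\{i\}\,;\,a_{ij}\neq0\}\subset S_i\subset\{1,\dots,N\}\setminus\{i\}$ for $i=1,\dots,M$. For every $\mathrm{U}\in\mathbb{R}^N$ let $\mathbb{B}(\mathrm{U})=(b_{ij}(\mathrm{U}))_{i,j=1}^N$ be a real matrix such that, for all $\mathrm{U}$: $b_{ij}(\mathrm{U})=b_{ji}(\mathrm{U})$ for $i,j=1,\dots,N$; $b_{ij}(\mathrm{U})\le 0$ for $i\ne j$, $i,j=1,\dots,N$; $\sum_{j=1}^N b_{ij}(\mathrm{U})=0$ for $i=1,\dots,N$; and $b_{ij}(\mathrm{U})=0$ for all $i=1,\dots,M$ and $j\notin S_i\cup\{i\}$. Assume (A2): for any $\mathrm{U}=(u_1,\dots,u_N)\in\mathbb{R}^N$ and any $i\in\{1,\dots,M\}$, if either $u_i>u_j$ for all $j\in S_i$ or $u_i<u_j$ for all $j\in S_i$, then $a_{ij}+b_{ij}(\mathrm{U})\le0$ for all $j\in S_i$. Let $\mathrm{U}=(u_1,\dots,u_N)\in\mathbb{R}^N$ be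 any vector satisfying $\sum_{j=1}^N (a_{ij}+b_{ij}(\mathrm{U}))\,u_j=g_i$ for $i=1,\dots,M$. Then, for all $i=1,\dots,M$, $$g_i\le 0\ \Rightarrow\ u_i\le\max_{j\in S_i}u_j^+,\qquad\qquad g_i\ge 0\ \Rightarrow\ u_i\ge\min_{j\in S_i}u_j^-.$$ If, in addition, $\sum_{j=1}^N a_{ij}=0$ for $i=1,\dots,M$, then, for all $i=1,\dots,M$, $$g_i\le 0\ \Rightarrow\ u_i\le\max_{j\in S_i}u_j,\qquad\qquad g_i\ge 0\ \Rightarrow\ u_i\ge\min_{j\in S_i}u_j.$$
   Context: For a real number $a$, $a^+=\max\{a,0\}$ and $a^-=\min\{a,0\}$. The sets $S_i$ (neighborhoods of the indices $i$) are understood to be nonempty, so that the maxima and minima over $S_i$ are defined. *)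

(* Defs.v *)
From mathcomp Require Import all_boot all_order all_algebra reals.

Set Implicit Arguments.
Unset Strict Implicit.
Unset Printing Implicit Defensive.

Import Order.TTheory GRing.Theory Num.Theory.
Local Open Scope ring_scope.

Definition emb (M N : nat) (hMN : (M < N)%N) : 'I_M -> 'I_N :=
  widen_ord (ltnW hMN).

(* The iteration starts from a value of f taken on S, so that no foreign default
   enters the result; the value 0 on the empty set is junk. *)
Definition max_over (R : realType) (I : finType) (S : {set I}) (f : I -> R) : R :=
  if [pick j in S] is Some j0 then \big[Num.max/f j0]_(j in S) f j else 0.

Definition min_over (R : realType) (I : finType) (S : {set I}) (f : I -> R) : R :=
  if [pick j in S] is Some j0 then \big[Num.min/f j0]_(j in S) f j else 0.

Lemma max_overP (R : realType) (I : finType) (S : {set I}) (f : I -> R) :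
  S != set0 ->
  (exists2 j, j \in S & max_over S f = f j) /\
  (forall j, j \in S -> f j <= max_over S f).
Proof.
move=> /set0Pn[k kS]; rewrite /max_over.
case: pickP => [j0 j0S|/(_ k)]; last by rewrite kS.
split; last by move=> j jS; apply: le_bigmax_cond.
apply: (big_ind (fun x => exists2 j, j \in S & x = f j)).
- by exists j0.
- move=> x y [i iS ->] [j jS ->].
  by case: (leP (f i) (f j)) => _; [exists j|exists i].
- by move=> i iS; exists i.
Qed.

Lemma min_overP (R : realType) (I : finType) (S : {set I}) (f : I -> R) :
  S != set0 ->
  (exists2 j, j \in S & min_over S f = f j) /\
  (forall j, j \in S -> min_over S f <= f j).
Proof.
move=> /set0Pn[k kS]; rewrite /min_over.
case: pickP => [j0 j0S|/(_ k)]; last by rewrite kS.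
split; last by move=> j jS; apply: bigmin_le_cond.
apply: (big_ind (fun x => exists2 j, j \in S & x = f j)).
- by exists j0.
- move=> x y [i iS ->] [j jS ->].
  by case: (leP (f i) (f j)) => _; [exists i|exists j].
- by move=> i iS; exists i.
Qed.

(* Main.v *)
(* If u_i exceeds every neighbouring value then (A2) makes the off-diagonal
   coefficients c_ij = a_ij + b_ij nonpositive on S_i, while c_ii > 0 because
   a_ii > 0 (definiteness at a basis vector) and b_ii >= 0 (zero row sum).
   Writing r_i for the row sum of a, which is also that of c,
     g_i = r_i u_i + sum_(j in S_i) c_ij (u_j - u_i),
   and the right-hand side is positive: its first term is positive if r_i > 0
   and u_i > 0, and if r_i = 0 then c_ii > 0 forces some c_ij < 0.  The lower
   bounds follow by applying this to -u. *)
Require Import Defs.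
From mathcomp Require Import all_boot all_order all_algebra reals.

Set Implicit Arguments.
Unset Strict Implicit.
Unset Printing Implicit Defensive.

Import Order.TTheory GRing.Theory Num.Theory.
Local Open Scope ring_scope.

(** A single abstract row lets the same argument run on [u] and on [-u]. Asking for the sign of
    [u i] only when the row sum is nonzero covers both halves of the theorem at once. *)
Lemma row_strict_max_gt0 (R : realDomainType) (I : finType) (S : {set I})
    (i : I) (c u : I -> R) :
  0 < c i -> 0 <= \sum_j c j ->
  (forall j, j \in S -> c j <= 0) -> (forall j, j \notin i |: S -> c j = 0) ->
  (forall j, j \in S -> u j < u i) -> (\sum_j c j != 0 -> 0 < u i) ->
  0 < \sum_j c j * u j.
Proof.
move=> ci_gt0 r_ge0 cS_le0 c_eq0 u_lt u_gt0.
have -> : \sum_j c j * u j = (\sum_j c j) * u i + \sum_j c j * (u j - u i).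
  rewrite mulr_suml -big_split; apply: eq_bigr => j _ /=.
  by rewrite -mulrDr addrC subrK.
have term_ge0 j : 0 <= c j * (u j - u i).
  have [jS|] := boolP (j \in i |: S); last by move=> /c_eq0 ->; rewrite mul0r.
  case/setU1P: jS => [->|jS]; first by rewrite subrr mulr0.
  by rewrite mulr_le0 ?cS_le0 // subr_le0 ltW ?u_lt.
have [r0|r_neq0] := eqVneq (\sum_j c j) 0; last first.
  apply: ltr_wpDr; first exact: sumr_ge0.
  by rewrite mulr_gt0 ?u_gt0 // lt_def r_neq0.
rewrite r0 mul0r add0r lt_def sumr_ge0 // andbT.
(* A zero sum of nonnegative terms makes each term vanish. As [u j - u i] is nonzero on [S], every
   off-diagonal [c j] is then 0, and the row sum collapses to [c i], which is positive. *)
apply/eqP => /(psumr_eq0P (fun j _ => term_ge0 j)) term0.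
have cj0 j : j != i -> c j = 0.
  move=> ji; have [jS|jS] := boolP (j \in S); last first.
    by apply: c_eq0; rewrite in_setU1 negb_or ji.
  move/eqP: (term0 j isT); rewrite mulf_eq0 subr_eq0 (lt_eqF (u_lt _ jS)) orbF.
  by move/eqP.
by move: r0 ci_gt0; rewrite (bigD1 i) //= big1 // addr0 => ->; rewrite ltxx.
Qed.

Lemma posdef_diag_gt0 (R : numDomainType) (M : nat) (A : 'M[R]_M) (i : 'I_M) :
  (forall v : 'cV[R]_M, v != 0 ->
     0 < \sum_(k < M) \sum_(l < M) v k 0 * A k l * v l 0) ->
  0 < A i i.
Proof.
move=> /(_ (delta_mx i 0)); rewrite (bigD1 i) //= (bigD1 i) //= !big1.
- rewrite !mxE !eqxx !addr0 mul1r mulr1; apply.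
  apply/eqP => /matrixP/(_ i 0); rewrite !mxE !eqxx.
  by apply/eqP; rewrite oner_eq0.
- move=> k ki; apply: big1 => l _.
  by rewrite !mxE (negPf ki) !mul0r.
- by move=> l li; rewrite !mxE (negPf li) mulr0.
Qed.

Theorem theorem2 (R : realType) (M N : nat) (hM : (0 < M)%N) (hMN : (M < N)%N)
  (A : 'M[R]_(M, N)) (g : 'cV[R]_M)
  (hrow : forall i : 'I_M, 0 <= \sum_(j < N) A i j)
  (hpos : forall v : 'cV[R]_M, v != 0 ->
     0 < \sum_(i < M) \sum_(j < M) v i 0 * A i (emb hMN j) * v j 0)
  (S : 'I_M -> {set 'I_N})
  (hS0 : forall i : 'I_M, S i != set0)
  (hSl : forall i : 'I_M,
     [set j | (j != emb hMN i) && (A i j != 0)] \subset S i)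
  (hSu : forall i : 'I_M, S i \subset [set~ emb hMN i])
  (B : 'cV[R]_N -> 'M[R]_N)
  (hBsym : forall (U : 'cV[R]_N) (i j : 'I_N), B U i j = B U j i)
  (hBle0 : forall (U : 'cV[R]_N) (i j : 'I_N), i != j -> B U i j <= 0)
  (hBsum : forall (U : 'cV[R]_N) (i : 'I_N), \sum_(j < N) B U i j = 0)
  (hBS : forall (U : 'cV[R]_N) (i : 'I_M) (j : 'I_N),
     j \notin emb hMN i |: S i -> B U (emb hMN i) j = 0)
  (hA2 : forall (U : 'cV[R]_N) (i : 'I_M),
     (forall j : 'I_N, j \in S i -> U j 0 < U (emb hMN i) 0) \/
     (forall j : 'I_N, j \in S i -> U (emb hMN i) 0 < U j 0) ->
     forall j : 'I_N, j \in S i -> A i j + B U (emb hMN i) j <= 0)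
  (U : 'cV[R]_N)
  (hU : forall i : 'I_M,
     \sum_(j < N) (A i j + B U (emb hMN i) j) * U j 0 = g i 0) :
  (forall i : 'I_M,
     (g i 0 <= 0 ->
        U (emb hMN i) 0 <= max_over (S i) (fun j => Num.max (U j 0) 0)) /\
     (0 <= g i 0 ->
        min_over (S i) (fun j => Num.min (U j 0) 0) <= U (emb hMN i) 0)) /\
  ((forall i : 'I_M, \sum_(j < N) A i j = 0) ->
   forall i : 'I_M,
     (g i 0 <= 0 -> U (emb hMN i) 0 <= max_over (S i) (fun j => U j 0)) /\
     (0 <= g i 0 -> min_over (S i) (fun j => U j 0) <= U (emb hMN i) 0)).
Proof.
have diag_gt0 i : 0 < A i (emb hMN i) + B U (emb hMN i) (emb hMN i).
  apply: ltr_pwDl.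
    (* Definiteness concerns the square block formed by the first [M] columns of [A]. *)
    have := @posdef_diag_gt0 R M (\matrix_(k, l) A k (emb hMN l)) i.
    rewrite mxE; apply => v /hpos; congr (0 < _).
    by apply: eq_bigr => k _; apply: eq_bigr => l _; rewrite mxE.
  move/eqP: (hBsum U (emb hMN i)); rewrite (bigD1 (emb hMN i)) //= addr_eq0.
  move=> /eqP ->; rewrite oppr_ge0; apply: sumr_le0 => j ji.
  by rewrite hBle0 // eq_sym.
have rowsumE i : \sum_(j < N) (A i j + B U (emb hMN i) j) = \sum_(j < N) A i j.
  by rewrite big_split /= hBsum addr0.
have off_eq0 i j : j \notin emb hMN i |: S i -> A i j + B U (emb hMN i) j = 0.
  move=> jS; rewrite hBS // addr0; apply/eqP; move: jS.
  rewrite in_setU1 negb_or => /andP[ji]; apply: contraNT => Aij.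
  by apply: (subsetP (hSl i)); rewrite inE ji.
(* Contrapositive shared by both upper bounds. *)
have max_gt0 i : (forall j, j \in S i -> U j 0 < U (emb hMN i) 0) ->
    (\sum_(j < N) A i j != 0 -> 0 < U (emb hMN i) 0) -> 0 < g i 0.
  move=> Ult U0; rewrite -hU.
  apply: (@row_strict_max_gt0 _ _ (S i) (emb hMN i)
            (fun j => A i j + B U (emb hMN i) j) (fun j => U j 0));
    rewrite ?rowsumE //; last exact: off_eq0.
  by apply: hA2; left.
have min_lt0 i : (forall j, j \in S i -> U (emb hMN i) 0 < U j 0) ->
    (\sum_(j < N) A i j != 0 -> U (emb hMN i) 0 < 0) -> g i 0 < 0.
  (* Negating [U] turns the strict minimum into a strict maximum and keeps the coefficients, whose
     signs come from the second alternative of (A2). *)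
  move=> Ugt U0; rewrite -hU -oppr_gt0 -sumrN.
  under eq_bigr do rewrite -mulrN.
  apply: (@row_strict_max_gt0 _ _ (S i) (emb hMN i)
            (fun j => A i j + B U (emb hMN i) j) (fun j => - U j 0));
    rewrite ?rowsumE ?oppr_gt0 //; [|exact: off_eq0|].
    by apply: hA2; right.
  by move=> j jS; rewrite ltrN2 Ugt.
split=> [i|r0 i]; split=> gi; rewrite leNgt; apply/negP.
- have [[k _ maxE] max_ub] :=
    max_overP (fun j => Num.max (U j 0) 0) (hS0 i).
  move=> lt_max; move: gi; rewrite leNgt => /negP; apply; apply: max_gt0.
    move=> j /max_ub; rewrite ge_max => /andP[Uj _].
    exact: le_lt_trans Uj lt_max.
  (* The maximum is attained at some [k], so it is at least 0, and [U] at [i] exceeds it. *)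
  by move=> _; apply: le_lt_trans lt_max; rewrite maxE le_max lexx orbT.
- have [[k _ minE] min_lb] :=
    min_overP (fun j => Num.min (U j 0) 0) (hS0 i).
  move=> lt_min; move: gi; rewrite leNgt => /negP; apply; apply: min_lt0.
    move=> j /min_lb; rewrite le_min => /andP[Uj _].
    exact: lt_le_trans lt_min Uj.
  (* Likewise the attained minimum is at most 0, so [U] at [i] is negative. *)
  by move=> _; apply: lt_le_trans lt_min _; rewrite minE ge_min lexx orbT.
- have [_ max_ub] := max_overP (fun j => U j 0) (hS0 i).
  move=> lt_max; move: gi; rewrite leNgt => /negP; apply; apply: max_gt0.
    by move=> j /max_ub Uj; apply: le_lt_trans Uj lt_max.
  (* With zero row sums the sign condition on [U] at [i] is vacuous, so no truncation at 0 enters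
     the bound. *)
  by rewrite r0 eqxx.
- have [_ min_lb] := min_overP (fun j => U j 0) (hS0 i).
  move=> lt_min; move: gi; rewrite leNgt => /negP; apply; apply: min_lt0.
    by move=> j /min_lb Uj; apply: lt_le_trans lt_min Uj.
  by rewrite r0 eqxx.
Qed.
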